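(* Let $\mathcal{C}$ be a Krull-Schmidt 2-Calabi-Yau triangulated category over a field $k$, and let $\mathcal{Z}$ be a functorially finite rigid subcategory of $\mathcal{C}$. If $\mathcal{C}$ has a cluster-tilting subcategory, then $\mathcal{C}$ has a cluster-tilting subcategory $\mathcal{R}$ which contains $\mathcal{Z}$.
   Context: $k$ is a field (not necessarily algebraically closed); all categories and functors are $k$-linear and essentially small. A Krull-Schmidt category is an additive category in which every object is a finite direct sum of objects with local endomorphism rings. A triangulated category is 2-Calabi-Yau if it is Hom-finite and has a Serre functor $\mathbb{S}$ (an auto-equivalence with natural isomorphisms $\operatorname{Hom}(X,Y)\cong\operatorname{Hom}(Y,\mathbb{S}X)^*$) with $\mathbb{S}\cong[2]$ as triangle functors. $\operatorname{Ext}^1(X,Y)=\operatorname{Hom}(X,Y[1])$. Subcategories are full and additive. A subcategory $\mathcal{Z}\subseteq\mathcal{C}$ is functorially finite if every object $X$ of $\mathcal{C}$ has a right $\mathcal{Z}$-approximation (a map $Z_0\to X$ with $Z_0\in\mathcal{Z}$ through which every map from an object of $\mathcal{Z}$ to $X$ factors) and, dually, a left $\mathcal{Z}$-approximation. It is rigid if $\operatorname{Ext}^1(Z,Z')=0$ for all $Z,Z'\in\mathcal{Z}$. A cluster-tilting subcategory is a functorially finite subcategory $\mathcal{T}$ with $\mathcal{T}=\{X\mid\operatorname{Ext}^1(\mathcal{T},X)=0\}=\{X\mid\operatorname{Ext}^1(X,\mathcal{T})=0\}$. *)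

(* Defs.v *)
From HB Require Import structures.
From mathcomp Require Import all_boot all_order all_algebra.

Set Implicit Arguments.
Unset Strict Implicit.
Unset Printing Implicit Defensive.

Import GRing.Theory.
Local Open Scope ring_scope.

Declare Scope cat_scope.
Delimit Scope cat_scope with C.
Reserved Notation "g \co f" (at level 40, left associativity).

(* [obj] and the Homs live in [Type], so every such category is small with
   respect to some universe: no separate size hypothesis is needed. *)
Record linCat (k : fieldType) := LinCat {
  obj :> Type;
  hom : obj -> obj -> lmodType k;
  idm : forall X, hom X X;
  comp : forall X Y Z, hom Y Z -> hom X Y -> hom X Z;
  comp_linear_l : forall X Y Z (f : hom X Y), linear (fun g : hom Y Z => comp g f);
  comp_linear_r : forall X Y Z (g : hom Y Z), linear (fun f : hom X Y => comp g f);
  comp1m : forall X Y (f : hom X Y), comp (idm Y) f = f;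
  compm1 : forall X Y (f : hom X Y), comp f (idm X) = f;
  compA : forall W X Y Z (h : hom Y Z) (g : hom X Y) (f : hom W X),
    comp h (comp g f) = comp (comp h g) f
}.

Notation "g \co f" := (comp g f) : cat_scope.
Local Open Scope cat_scope.

Section LinearCategories.
Context {k : fieldType}.
Implicit Types C D E : linCat k.

Definition is_iso C (X Y : C) (f : hom X Y) : Prop :=
  exists g : hom Y X, g \co f = idm X /\ f \co g = idm Y.

Definition hom_zero C (X Y : C) : Prop := forall f : hom X Y, f = 0.

Definition hom_finite C : Prop :=
  forall X Y : C, exists n, inhabited (Vector.axiom n (hom X Y)).

(* For n = 0 the last condition reads [0 = idm X]: X is a zero object. *)
Definition direct_sum C n (Y : 'I_n -> C) (X : C) : Prop :=
  exists (i : forall j, hom (Y j) X) (p : forall j, hom X (Y j)),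
    [/\ forall j, p j \co i j = idm (Y j),
        forall j l, j != l -> p j \co i l = 0
      & \sum_(j < n) (i j \co p j) = idm X].

Definition zero_object C (X : C) : Prop :=
  forall Y : C, hom_zero X Y /\ hom_zero Y X.

(* The full subcategory on the objects satisfying P is an additive category.
   P is required to be closed neither under isomorphism nor under direct
   summands. *)
Definition additive_subcategory C (P : C -> Prop) : Prop :=
  forall n (Y : 'I_n -> C), (forall j, P (Y j)) ->
    exists2 X, P X & direct_sum Y X.

Definition additive C : Prop := additive_subcategory (fun _ : C => True).

(* A nonzero ring in which the sum of two non-units is a non-unit. *)
Definition local_endo C (X : C) : Prop :=
  idm X <> 0 /\
  forall f g : hom X X, ~ is_iso f -> ~ is_iso g -> ~ is_iso (f + g).

Definition krull_schmidt C : Prop :=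
  additive C /\
  forall X : C, exists n (Y : 'I_n -> C),
    (forall j, local_endo (Y j)) /\ direct_sum Y X.

Record functor C D := Functor {
  fobj :> C -> D;
  fmap : forall X Y, hom X Y -> hom (fobj X) (fobj Y);
  fmap_linear : forall X Y, linear (@fmap X Y);
  fmap1 : forall X, fmap (idm X) = idm (fobj X);
  fmapM : forall X Y Z (g : hom Y Z) (f : hom X Y),
    fmap (g \co f) = fmap g \co fmap f
}.

Definition functor_id C : functor C C.
Proof. by exists id (fun _ _ f => f). Defined.

Definition functor_comp C D E (G : functor D E) (F : functor C D) :
  functor C E.
Proof.
exists (fun X => G (F X)) (fun _ _ f => fmap G (fmap F f)).
- by move=> X Y a f g; rewrite !fmap_linear.
- by move=> X; rewrite !fmap1.
- by move=> X Y Z g f; rewrite !fmapM.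
Defined.

Definition nat_iso C D (F G : functor C D) (t : forall X, hom (F X) (G X)) :
    Prop :=
  (forall X Y (f : hom X Y), t Y \co fmap F f = fmap G f \co t X) /\
  (forall X, is_iso (t X)).

Definition equivalence C D (F : functor C D) : Prop :=
  exists (G : functor D C) eta eps,
    nat_iso (F := functor_id C) (G := functor_comp G F) eta /\
    nat_iso (F := functor_comp F G) (G := functor_id D) eps.

Definition right_approx C (P : C -> Prop) (X Z0 : C) (f : hom Z0 X) : Prop :=
  P Z0 /\ forall Z (g : hom Z X), P Z -> exists h : hom Z Z0, g = f \co h.

Definition left_approx C (P : C -> Prop) (X Z0 : C) (f : hom X Z0) : Prop :=
  P Z0 /\ forall Z (g : hom X Z), P Z -> exists h : hom Z0 Z, g = h \co f.

Definition functorially_finite C (P : C -> Prop) : Prop :=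
  forall X : C, (exists Z0 (f : hom Z0 X), right_approx P f) /\
                (exists Z0 (f : hom X Z0), left_approx P f).

(* [eta X Y f] is the functional on Hom(Y, S X) attached to f by
   Hom(X, Y) ~ Hom(Y, S X)^*; surjectivity and injectivity are expressed by
   [exists!]. *)
Definition serre_duality C (S : functor C C)
    (eta : forall X Y : C, hom X Y -> {scalar hom Y (S X)}) : Prop :=
  [/\ forall X Y a (f f' : hom X Y) g,
        eta X Y (a *: f + f') g = a * eta X Y f g + eta X Y f' g,
      forall X Y (phi : {scalar hom Y (S X)}),
        exists! f : hom X Y, eta X Y f =1 phi
    & forall X X' Y Y' (a : hom X' X) (b : hom Y Y') (f : hom X Y) g,
        eta X' Y' (b \co f \co a) g = eta X Y f (fmap S a \co g \co b)].

Definition serre_functor C (S : functor C C) eta : Prop :=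
  equivalence S /\ @serre_duality C S eta.

End LinearCategories.

Record triCat (k : fieldType) := TriCat {
  tri_lin :> linCat k;
  tri_additive : additive tri_lin;
  shift : functor tri_lin tri_lin;
  shift_equivalence : equivalence shift;
  (* [dist u v w]: X -u-> Y -v-> Z -w-> X[1] is a distinguished triangle *)
  dist : forall X Y Z : tri_lin,
    hom X Y -> hom Y Z -> hom Z (shift X) -> Prop;
  TR1_iso : forall X Y Z X' Y' Z' u v w u' v' w'
      (a : hom X X') (b : hom Y Y') (c : hom Z Z'),
    @dist X Y Z u v w -> is_iso a -> is_iso b -> is_iso c ->
    b \co u = u' \co a -> c \co v = v' \co b ->
    fmap shift a \co w = w' \co c -> @dist X' Y' Z' u' v' w';
  TR1_id : forall X O, zero_object O -> @dist X X O (idm X) 0 0;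
  TR1_cone : forall X Y (u : hom X Y), exists Z v w, @dist X Y Z u v w;
  TR2 : forall X Y Z u v w,
    @dist X Y Z u v w <-> @dist Y Z (shift X) v w (- fmap shift u);
  TR3 : forall X Y Z X' Y' Z' u v w u' v' w'
      (a : hom X X') (b : hom Y Y'),
    @dist X Y Z u v w -> @dist X' Y' Z' u' v' w' -> b \co u = u' \co a ->
    exists c : hom Z Z', c \co v = v' \co b /\ fmap shift a \co w = w' \co c;
  TR4 : forall X Y Z X' Y' Z' (u : hom X Y) (v : hom Y Z) i i' j j' m m',
    @dist X Y Z' u i i' -> @dist Y Z X' v j j' ->
    @dist X Z Y' (v \co u) m m' ->
    exists (f : hom Z' Y') (g : hom Y' X'),
      [/\ @dist Z' Y' X' f g (fmap shift i \co j'),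
          f \co i = m \co v, m' \co f = i',
          g \co m = j & j' \co g = fmap shift u \co m']
}.


Section TriangulatedCategories.
Context {k : fieldType}.
Implicit Type C : triCat k.

Definition shift2 C : functor C C := functor_comp (shift C) (shift C).

Definition commutator C (F : functor C C) : Type :=
  forall X, hom (F (shift C X)) (shift C (F X)).

Definition triangle_functor C (F : functor C C) (phi : commutator F) : Prop :=
  nat_iso (F := functor_comp F (shift C)) (G := functor_comp (shift C) F) phi /\
  forall X Y Z (u : hom X Y) (v : hom Y Z) (w : hom Z (shift C X)),
    dist u v w -> dist (fmap F u) (fmap F v) (phi X \co fmap F w).

(* The commutator of [2]: the signs of the two copies of [1], each with
   commutator -1, cancel. *)
Definition shift2_commutator C : commutator (shift2 C) := fun X => idm _.

Definition triangle_functor_iso C (F G : functor C C) (phi : commutator F)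
    (psi : commutator G) : Prop :=
  exists t : forall X, hom (F X) (G X), nat_iso t /\
    forall X, fmap (shift C) (t X) \co phi X = psi X \co t (shift C X).

(* The commutator S[1] -> [1]S that Serre duality induces.  With the trace form
   Tr_X : Hom(X, S X) -> k, Tr_X g = eta X X (idm X) g, it is determined by
     Tr_(X[1]) (phi_X^-1 \co g[1]) = - Tr_X g;
   the sign is the one for which (S, phi) preserves distinguished triangles.
   The equation is written with h = phi_X^-1 \co g[1]. *)
Definition serre_commutator C (S : functor C C)
    (eta : forall X Y : C, hom X Y -> {scalar hom Y (S X)})
    (phi : commutator S) : Prop :=
  forall X (g : hom X (S X)) (h : hom (shift C X) (S (shift C X))),
    phi X \co h = fmap (shift C) g ->
    eta _ _ (idm (shift C X)) h = - eta _ _ (idm X) g.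

Definition two_calabi_yau C : Prop :=
  hom_finite C /\
  exists (S : functor C C) eta (phi : commutator S),
    [/\ serre_functor eta, serre_commutator eta phi, triangle_functor phi
      & triangle_functor_iso phi (@shift2_commutator C)].

Definition ext1_zero C (X Y : C) : Prop := hom_zero X (shift C Y).

Definition rigid C (P : C -> Prop) : Prop :=
  forall X Y, P X -> P Y -> ext1_zero X Y.

Definition cluster_tilting C (T : C -> Prop) : Prop :=
  [/\ additive_subcategory T, functorially_finite T,
      forall X, T X <-> (forall Y, T Y -> ext1_zero Y X)
    & forall X, T X <-> (forall Y, T Y -> ext1_zero X Y)].

Lemma shift2_triangle_functor C : triangle_functor (@shift2_commutator C).
Proof.
split.
  split=> [X Y f|X]; first by rewrite comp1m compm1.
  by exists (idm _); rewrite comp1m.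
have oppf (X Y : C) (f : hom X Y) :
    fmap (shift C) (- f) = - fmap (shift C) f.
  have l := fmap_linear (shift C) (X := X) (Y := Y).
  have z : fmap (shift C) (0 : hom X Y) = 0.
    have := l 1 0 0; rewrite !scale1r addr0 => e.
    by apply: (addrI (fmap (shift C) (0 : hom X Y))); rewrite -e addr0.
  by have := l (-1) f 0; rewrite !scaleN1r z !addr0.
move=> X Y Z u v w /TR2/TR2/TR2/TR2/TR2/TR2.
by rewrite !oppf !opprK comp1m.
Qed.

End TriangulatedCategories.

(* Main.v *)
Require Import Defs.
From HB Require Import structures.
From mathcomp Require Import all_boot all_order all_algebra.

(** The completion of Z is the Bongartz completion relative to a
    cluster-tilting subcategory T.  A right Z-approximation Z0 -> T[1] of the
    shift of an object T of T completes to a triangle T -> U -> Z0 -> T[1]; as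
    Z is rigid, Ext^1(Z, U) = 0.  Let U range over all objects which sit in
    such a triangle and satisfy Ext^1(Z, U) = 0 ([completion]), and let R
    consist of the X with Ext^1(Z, X) = 0 and Ext^1(U, X) = 0
    ([completion_perp]).

    The Calabi-Yau condition enters through the symmetry of the relation
    Ext^1(X, Y) = 0 ([ext1_zero_sym]).  With it, a diagram chase along the
    defining triangles shows that any two objects U, U' of the family satisfy
    Ext^1(U, U') = 0 ([completion_ext]), so that R contains both Z and the
    family.

    The other half is that every object Y[1] has a right R-approximation
    E -> Y[1] with E in the family ([completion_approx]).  This takes two
    corrections.  First, let V be the cone of a left Z-approximation Y -> Z';
    then Ext^1(Z, V) = 0, and every map X -> Y[1] with Ext^1(X, Z) = 0 factors
    through V -> Y[1].  Secondly, write V = Y'[1] and let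
    Y' -> T1 -> T0 -> V be the triangle on a left T-approximation, so that
    T0 lies in T.  Composing with T1 -> U1 and applying the octahedral axiom
    gives an object E with triangles

      Y' -> U1 -> E -> V   and   T0 -> E -> Z1 -> T0[1].

    The first shows that Ext^1(Z, E) = 0 and that E -> V is an
    R-approximation; with the second, E belongs to the family.

    If X is in R, its approximation E -> X splits, so R consists of retracts of
    the family and is therefore rigid.  An object X with Ext^1(R, X) = 0 is in R
    because R contains Z and the family.  Finally the cocone R1 of E -> Y[1]
    lies in R, and Y -> R1 is a left R-approximation of Y. *)

Set Implicit Arguments.
Unset Strict Implicit.
Unset Printing Implicit Defensive.

Import GRing.Theory.
(* Restores [hom], which also names an operation on vector spaces. *)
Import Defs.
Local Open Scope ring_scope.
Local Open Scope cat_scope.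

(** * Linear categories and equivalences *)

Section Linear.
Context {k : fieldType}.
Implicit Types C D : linCat k.

Lemma comp0l C (X Y Z : C) (f : hom X Y) : (0 : hom Y Z) \co f = 0.
Proof.
by have := comp_linear_l f (-1) 0 (0 : hom Y Z); rewrite !scaleN1r !addNr.
Qed.

Lemma comp0r C (X Y Z : C) (g : hom Y Z) : g \co (0 : hom X Y) = 0.
Proof.
by have := comp_linear_r g (-1) 0 (0 : hom X Y); rewrite !scaleN1r !addNr.
Qed.

Lemma compDl C (X Y Z : C) (g h : hom Y Z) (f : hom X Y) :
  (g + h) \co f = g \co f + h \co f.
Proof.
by have := comp_linear_l f 1 g h; rewrite !scale1r.
Qed.

Lemma compNl C (X Y Z : C) (g : hom Y Z) (f : hom X Y) :
  (- g) \co f = - (g \co f).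
Proof.
by have := comp_linear_l f (-1) g 0; rewrite !scaleN1r comp0l !addr0.
Qed.

Lemma compNr C (X Y Z : C) (g : hom Y Z) (f : hom X Y) :
  g \co (- f) = - (g \co f).
Proof.
by have := comp_linear_r g (-1) f 0; rewrite !scaleN1r comp0r !addr0.
Qed.

Lemma fmap0 C D (F : functor C D) (X Y : C) : fmap F (0 : hom X Y) = 0.
Proof.
by have := fmap_linear F (-1) 0 (0 : hom X Y); rewrite !scaleN1r !addNr.
Qed.

Lemma fmapD C D (F : functor C D) (X Y : C) (f g : hom X Y) :
  fmap F (f + g) = fmap F f + fmap F g.
Proof.
by have := fmap_linear F 1 f g; rewrite !scale1r.
Qed.

Lemma fmapN C D (F : functor C D) (X Y : C) (f : hom X Y) :
  fmap F (- f) = - fmap F f.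
Proof.
by have := fmap_linear F (-1) f 0; rewrite !scaleN1r fmap0 !addr0.
Qed.

Lemma idm_iso C (X : C) : is_iso (idm X).
Proof. by exists (idm X); rewrite comp1m. Qed.

Lemma zero_object_idm C (X : C) : idm X = 0 -> zero_object X.
Proof.
move=> X0 Y; split=> f; first by rewrite -(compm1 f) X0 comp0r.
by rewrite -(comp1m f) X0 comp0l.
Qed.

Lemma additive_zero_object C : additive C -> exists O : C, zero_object O.
Proof.
have Y : 'I_0 -> C by case.
move=> /(_ 0%N Y) [// | O _ [i [p [_ _]]]]; rewrite big_ord0 => O0.
by exists O; apply: zero_object_idm.
Qed.

Lemma equivalence_faithful C D (F : functor C D) (X Y : C) (f g : hom X Y) :
  equivalence F -> fmap F f = fmap F g -> f = g.
Proof.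
case=> G [eta [_ [[nat_eta iso_eta] _]]] efg.
have [theta [theta_eta _]] := iso_eta Y.
have etaE (h : hom X Y) : h = theta \co fmap G (fmap F h) \co eta X.
  by rewrite -compA -(nat_eta X Y h) compA theta_eta comp1m.
by rewrite (etaE f) efg -etaE.
Qed.

Lemma equivalence_full C D (F : functor C D) (X Y : C) (g : hom (F X) (F Y)) :
  equivalence F -> exists f : hom X Y, fmap F f = g.
Proof.
move=> eqvF; have [G [eta [eps [[nat_eta iso_eta] [nat_eps iso_eps]]]]] := eqvF.
have [theta [theta_eta eta_theta]] := iso_eta Y.
pose f := theta \co fmap G g \co eta X; exists f.
(* G is faithful because F G is isomorphic to the identity. *)
have G_faithful (h h' : hom (F X) (F Y)) : fmap G h = fmap G h' -> h = h'.
  move=> ehh'; have [d [_ epsd]] := iso_eps (F X).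
  have epsE (e : hom (F X) (F Y)) :
      e = eps (F Y) \co fmap F (fmap G e) \co d.
    by rewrite (nat_eps _ _ e) -compA epsd compm1.
  by rewrite (epsE h) ehh' -epsE.
apply: G_faithful.
have [d [_ etad]] := iso_eta X.
have := nat_eta X Y f; rewrite /= /f !compA eta_theta comp1m => e.
by rewrite -[LHS]compm1 -[RHS]compm1 -etad !compA e.
Qed.

Lemma equivalence_dense C D (F : functor C D) (Y : D) :
  equivalence F -> exists (X : C) (e : hom (F X) Y), is_iso e.
Proof. by case=> G [_ [eps [_ [_ iso_eps]]]]; exists (G Y), (eps Y); apply: iso_eps. Qed.

End Linear.

Section Triangulated.
Context {k : fieldType} {C : triCat k}.
Implicit Types (P : C -> Prop) (M W X Y Z : C).
Local Notation S := (shift C).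

(** * Exactness of Hom on distinguished triangles *)

Lemma shift_full X Y (g : hom (S X) (S Y)) : exists f, fmap S f = g.
Proof. exact/equivalence_full/shift_equivalence. Qed.

Lemma shift_faithful X Y (f g : hom X Y) : fmap S f = fmap S g -> f = g.
Proof. exact/equivalence_faithful/shift_equivalence. Qed.

(** Rotating back needs the third map: the triangle on w is the triangle on its
    cone, rotated, after the cone and its two maps are desuspended. *)
Lemma dist_cocone X Z (w : hom Z (S X)) :
  exists Y (u : hom X Y) (v : hom Y Z), dist u v w.
Proof.
have [Q [a [b dist_w]]] := TR1_cone w.
have [Y [e [d [de ed]]]] := equivalence_dense Q (shift_equivalence C).
have [u uE] := shift_full (- (d \co a)); have [v vE] := shift_full (- (b \co e)).
exists Y, u, v; apply/TR2/TR2; rewrite uE vE !opprK.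
apply: (TR1_iso dist_w (idm_iso Z) (idm_iso (S X)) (c := d)).
- by exists e.
- by rewrite comp1m compm1.
- by rewrite compm1.
- by rewrite fmap1 comp1m -compA ed compm1.
Qed.

Lemma dist_zero_id O X : zero_object O -> dist (0 : hom O X) (idm X) 0.
Proof.
move=> O0; apply/TR2; rewrite fmap0 oppr0; apply: TR1_id.
by apply: zero_object_idm; rewrite -fmap1 (proj1 (O0 O) (idm O)) fmap0.
Qed.

Section Exactness.
Variables (X Y Z : C) (u : hom X Y) (v : hom Y Z) (w : hom Z (S X)).
Hypothesis dist_uvw : dist u v w.

(** Maps the rotated triangle W -> 0 -> W[1] to Y -> Z -> X[1]. *)
Lemma dist_lift W (f : hom W Y) : v \co f = 0 -> exists g, f = u \co g.
Proof.
move=> vf0; have [O O0] := additive_zero_object (@tri_additive k C).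
have dist_W := proj1 (TR2 _ _ _) (TR1_id W O0).
have [|c [_]] := TR3 (b := 0 : hom O Z) (a := f) dist_W (proj1 (TR2 _ _ _) dist_uvw).
  by rewrite vf0 comp0l.
rewrite fmap1 compNr compm1 compNl => /oppr_inj fE.
have [g gE] := shift_full c; exists g; apply: shift_faithful.
by rewrite fmapM gE.
Qed.

(** Maps the triangle X -> Y -> Z to 0 -> W -> W. *)
Lemma dist_extend W (f : hom Y W) : f \co u = 0 -> exists g, f = g \co v.
Proof.
move=> fu0; have [O O0] := additive_zero_object (@tri_additive k C).
have [|c [cE _]] := TR3 (a := 0 : hom X O) (b := f) dist_uvw (dist_zero_id W O0).
  by rewrite fu0 comp0l.
by exists c; rewrite cE comp1m.
Qed.

Lemma dist_comp0 : v \co u = 0.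
Proof.
have [O O0] := additive_zero_object (@tri_additive k C).
have [|c [cE _]] := TR3 (a := idm X) (b := u) (TR1_id X O0) dist_uvw.
  by [].
by rewrite -cE comp0r.
Qed.

End Exactness.

Lemma dist_shift_comp0 X Y Z (u : hom X Y) (v : hom Y Z) w :
  dist u v w -> fmap S u \co w = 0.
Proof.
move=> /TR2/TR2/dist_comp0; rewrite compNl => /eqP.
by rewrite oppr_eq0 => /eqP.
Qed.

Lemma dist_shift_lift X Y Z (u : hom X Y) (v : hom Y Z) w W (f : hom W (S Y)) :
  dist u v w -> fmap S v \co f = 0 -> exists g, f = fmap S u \co g.
Proof.
move=> /TR2/TR2/TR2/dist_lift lift_f vf0.
have [|g ->] := lift_f W f; first by rewrite compNl vf0 oppr0.
by exists (- g); rewrite compNl compNr.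
Qed.

(** * Vanishing of Ext^1 *)

(** Serre duality embeds Hom(Y, X[1]) into the dual of
    Hom(X[1], F Y), where F is the Serre functor, and
    Hom(X[1], F Y) ~ Hom(X[1], Y[2]) ~ Hom(X, Y[1]). *)
Lemma ext1_zero_sym X Y :
  two_calabi_yau C -> ext1_zero X Y -> ext1_zero Y X.
Proof.
move=> [_ [F [eta [phi [[_ [eta_lin eta_bij _]] _ _ [t [[_ t_iso] _]]]]]]] XY0 f.
have YX0 (g : hom (S X) (F Y)) : g = 0.
  have [s [st _]] := t_iso Y; have [h hE] := shift_full (t Y \co g).
  by rewrite -(comp1m g) -st -compA -hE (XY0 h) fmap0 comp0r.
have [f0 [_ f0_uniq]] := eta_bij Y (S X) (eta _ _ 0).
by rewrite -(f0_uniq f) ?(f0_uniq 0) // => g; rewrite (YX0 g) !linear0.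
Qed.

Lemma ext1_zero_dist W X Y Z (u : hom X Y) (v : hom Y Z) w :
  dist u v w -> ext1_zero W X -> ext1_zero W Z -> ext1_zero W Y.
Proof.
move=> dist_uvw WX0 WZ0 f.
have [|g ->] := dist_shift_lift dist_uvw (f := f); first exact: WZ0.
by rewrite (WX0 g) comp0r.
Qed.

(** One half of Wakamatsu's lemma; its dual follows.  The long exact sequence
    at Ext^1 turns surjectivity of composition with an approximation into a
    vanishing. *)
Lemma ext1_zero_cone P X M (Q : C) (u : hom X M) (v : hom M Q) w :
  rigid P -> left_approx P u -> dist u v w -> forall Y, P Y -> ext1_zero Q Y.
Proof.
move=> rigP [PM u_approx] dist_uvw Y PY f.
have [|g ->] := dist_extend (proj1 (TR2 _ _ _) dist_uvw) (f := f).
  exact: rigP.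
have [g0 <-] := shift_full g; have [h ->] := u_approx Y g0 PY.
by rewrite fmapM -compA (dist_shift_comp0 dist_uvw) comp0r.
Qed.

Lemma ext1_zero_cocone X Y Z (u : hom X Y) (v : hom Y Z) w W :
  dist u v w -> (forall g : hom W (S X), exists h, g = w \co h) ->
  ext1_zero W Z -> ext1_zero W Y.
Proof.
move=> dist_uvw w_approx WZ0 f.
have [|g ->] := dist_shift_lift dist_uvw (f := f); first exact: WZ0.
have [h ->] := w_approx g.
by rewrite compA (dist_shift_comp0 dist_uvw) comp0l.
Qed.

Lemma ext1_zero_sum W n (Y : 'I_n -> C) X :
  direct_sum Y X -> (forall j, ext1_zero W (Y j)) -> ext1_zero W X.
Proof.
move=> [i [p [_ _ ip1]]] WY0 f; rewrite -(comp1m f) -fmap1 -ip1.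
elim/big_rec: _ => [|j g _ IH]; first by rewrite fmap0 comp0l.
by rewrite fmapD compDl IH addr0 fmapM -compA (WY0 j (_ \co f)) comp0r.
Qed.

(** * The completion *)

Section Completion.
Variables T Z : C -> Prop.
Hypotheses (CY : two_calabi_yau C) (T_ct : cluster_tilting T).
Hypotheses (Z_ff : functorially_finite Z) (Z_rigid : rigid Z).

(** For a triangle as below, the vanishing of Ext^1(Z, U) says that
    Z0 -> T0[1] is a right Z-approximation.  Stating the vanishing instead of
    the approximation makes it possible to recognize the object produced by
    the octahedral axiom in [completion_cone]. *)
Definition completion (U : C) : Prop :=
  (exists T0 Z0 (a : hom T0 U) (b : hom U Z0) c,
     [/\ T T0, Z Z0 & dist a b c]) /\
  forall Z1, Z Z1 -> ext1_zero Z1 U.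

Definition completion_perp (X : C) : Prop :=
  (forall Z1, Z Z1 -> ext1_zero Z1 X) /\
  (forall U, completion U -> ext1_zero U X).

Lemma cluster_tilting_rigid : rigid T.
Proof. by case: T_ct => _ _ T_perp _ X Y TX /T_perp; apply. Qed.

Lemma completion_exists T0 : T T0 ->
  exists U Z0 (a : hom T0 U) (b : hom U Z0) c,
    [/\ completion U, Z Z0 & dist a b c].
Proof.
move=> TT0; have [[Z0 [c [ZZ0 c_approx]]] _] := Z_ff (S T0).
have [U [a [b dist_abc]]] := dist_cocone c.
exists U, Z0, a, b, c; split=> //; split; first by exists T0, Z0, a, b, c.
move=> Z1 ZZ1; apply: (ext1_zero_cocone dist_abc) => [g|].
  exact: c_approx.
exact: Z_rigid.
Qed.

(** For U and U' with triangles T0 -> U -> Z0 and T0' -> U' -> Z0', a map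
    U -> U'[1] lifts to T0'[1] since Ext^1(U, Z0') = 0; the lift kills T0 since
    T is rigid, hence comes from Z0, and Ext^1(Z0, U') = 0. *)
Lemma completion_ext U U' : completion U -> completion U' -> ext1_zero U U'.
Proof.
move=> [[T0 [Z0 [a [b [c [TT0 ZZ0 dist_abc]]]]]] ZU0].
move=> [[T1 [Z1 [a' [b' [c' [TT1 ZZ1 dist_abc']]]]]] ZU'0] f.
have [|g ->] := dist_shift_lift dist_abc' (f := f).
  exact: (ext1_zero_sym CY (ZU0 _ ZZ1)).
have [|h ->] := dist_extend dist_abc (f := g).
  exact: (cluster_tilting_rigid TT0 TT1).
by rewrite compA (ZU'0 _ ZZ0 (_ \co h)) comp0l.
Qed.

Lemma perp_contains X : Z X -> completion_perp X.
Proof.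
move=> ZX; split=> [Z1 ZZ1|U [_ ZU0]]; first exact: Z_rigid.
exact/(ext1_zero_sym CY)/ZU0.
Qed.

Lemma completion_in_perp U : completion U -> completion_perp U.
Proof. by move=> cU; split=> [|U' cU']; [case: cU | apply: completion_ext]. Qed.

(** The homotopy pushout of Y -> T1 -> T0 along T1 -> U1. *)
Lemma completion_cone Y : (forall Z1, Z Z1 -> ext1_zero Z1 (S Y)) ->
  exists U E (u : hom Y U) (v : hom U E) w,
    [/\ completion U, completion E & dist u v w].
Proof.
move=> ZY0; have [_ T_ff _ T_coperp] := T_ct.
have [_ [T1 [u u_approx]]] := T_ff Y; have [TT1 _] := u_approx.
have [T0 [i [i' dist_u]]] := TR1_cone u.
have TT0 : T T0.
  apply/T_coperp; exact: ext1_zero_cone cluster_tilting_rigid u_approx dist_u.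
have [U [Z1 [v [j [j' [cU ZZ1 dist_v]]]]]] := completion_exists TT1.
have [E [m [m' dist_vu]]] := TR1_cone (v \co u).
have [f [g [dist_E _ _ _ _]]] := TR4 dist_u dist_v dist_vu.
exists U, E, (v \co u), m, m'; split=> //; split.
  by exists T0, Z1, f, g, (fmap S i \co j').
move=> Z2 ZZ2; apply: (ext1_zero_dist (proj1 (TR2 _ _ _) dist_vu)).
  by case: cU => _; apply.
exact: ZY0.
Qed.

(** With Y -> Z' a left Z-approximation of cone V and with U -> E -> V -> U[1]
    the triangle of [completion_cone], a map from an object X of the
    perpendicular category to Y[1] lifts to V because Ext^1(X, Z') = 0, and
    then to E because Ext^1(X, U) = 0. *)
Lemma completion_approx_shift Y : exists E (f : hom E (S Y)),
  completion E /\
  forall X (g : hom X (S Y)), completion_perp X -> exists h, g = f \co h.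
Proof.
have [_ [Z0 [l l_approx]]] := Z_ff Y; have [ZZ0 _] := l_approx.
have [V [m [n dist_l]]] := TR1_cone l.
have VZ0 := ext1_zero_cone Z_rigid l_approx dist_l.
have [Y' [e [d [de ed]]]] := equivalence_dense V (shift_equivalence C).
have [|U [E [u [v [w [cU cE dist_u]]]]]] := @completion_cone Y'.
  move=> Z1 ZZ1 f; rewrite -(comp1m f) -fmap1 -de fmapM -compA.
  by rewrite (ext1_zero_sym CY (VZ0 _ ZZ1) (_ \co f)) comp0r.
exists E, (n \co e \co w); split=> // X g [ZX0 UX0].
have [|g1 ->] := dist_lift (proj1 (TR2 _ _ _) (proj1 (TR2 _ _ _) dist_l)) (f := g).
  exact: (ext1_zero_sym CY (ZX0 _ ZZ0)).
have [|g2 g2E] := dist_lift (proj1 (TR2 _ _ _) (proj1 (TR2 _ _ _) dist_u))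
    (f := d \co g1).
  exact: (ext1_zero_sym CY (UX0 _ cU)).
by exists g2; rewrite -!compA -g2E compA compA -(compA n) ed compm1.
Qed.

Lemma completion_approx X : exists E (f : hom E X),
  completion E /\
  forall X1 (g : hom X1 X), completion_perp X1 -> exists h, g = f \co h.
Proof.
have [Y [e [d [de ed]]]] := equivalence_dense X (shift_equivalence C).
have [E [f [cE f_approx]]] := completion_approx_shift Y.
exists E, (e \co f); split=> // X1 g pX1.
have [h hE] := f_approx X1 (d \co g) pX1.
by exists h; rewrite -compA -hE compA ed comp1m.
Qed.

(** The approximation of X splits, so X is a retract of an object of the
    completion. *)
Lemma perp_rigid : rigid completion_perp.
Proof.
move=> X Y pX [_ UY0] f.
have [E [r [cE r_approx]]] := completion_approx X.
have [s sE] := r_approx X (idm X) pX.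
by rewrite -(compm1 f) sE compA (UY0 _ cE (f \co r)) comp0l.
Qed.

Lemma perpP X :
  completion_perp X <-> (forall Y, completion_perp Y -> ext1_zero Y X).
Proof.
split=> [pX Y pY|YX0]; first exact: perp_rigid.
by split=> Y ?; apply: YX0; [apply: perp_contains | apply: completion_in_perp].
Qed.

(** A left approximation of Y is the first map of the triangle on the right
    approximation of Y[1]: by [ext1_zero_cocone] the cocone of the latter lies
    in the perpendicular category again. *)
Lemma perp_functorially_finite : functorially_finite completion_perp.
Proof.
move=> Y; split.
  have [E [f [cE f_approx]]] := completion_approx Y.
  exists E, f; split=> [|X g]; first exact: completion_in_perp.
  exact: f_approx.
have [E [f [cE f_approx]]] := completion_approx_shift Y.
have pE := completion_in_perp cE.
have [X0 [u [v dist_f]]] := dist_cocone f.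
exists X0, u; split=> [|X g pX].
  apply/perpP => W pW; apply: (ext1_zero_cocone dist_f) => [h|].
    exact: f_approx.
  exact: perp_rigid.
have [|h hE] := dist_extend (proj1 (TR2 _ _ _) (proj1 (TR2 _ _ _) dist_f))
    (f := fmap S g).
  exact: (perp_rigid pE pX).
have [h0 h0E] := shift_full h; exists (- h0); apply: shift_faithful.
by rewrite hE fmapM fmapN h0E compNl compNr.
Qed.

Lemma perp_cluster_tilting : cluster_tilting completion_perp.
Proof.
split; [|exact: perp_functorially_finite|exact: perpP|].
  move=> n Y pY; have [//|X _ sumX] := tri_additive (n := n) (Y := Y).
  exists X => //; split=> W W_in; apply: (ext1_zero_sum sumX) => j.
    by have [ZY0 _] := pY j; apply: ZY0.
  by have [_ UY0] := pY j; apply: UY0.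
move=> X; split=> [/perpP YX0 Y pY|XY0].
  exact/(ext1_zero_sym CY)/YX0.
by apply/perpP => Y pY; apply/(ext1_zero_sym CY)/XY0.
Qed.

End Completion.
End Triangulated.

Theorem theorem1p6 (k : fieldType) (C : triCat k) (Z : C -> Prop)
    (C_krull_schmidt : krull_schmidt C)
    (C_calabi_yau : two_calabi_yau C)
    (Z_additive : additive_subcategory Z)
    (Z_functorially_finite : functorially_finite Z)
    (Z_rigid : rigid Z)
    (C_cluster_tilting : exists T : C -> Prop, cluster_tilting T) :
  exists R : C -> Prop, cluster_tilting R /\ (forall X : C, Z X -> R X).
Proof.
have [T T_ct] := C_cluster_tilting; exists (completion_perp T Z); split.
  exact: perp_cluster_tilting.
by move=> X; apply: perp_contains.
Qed.
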